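(* Let $\mathcal A$ and $\mathcal B$ be clones on sets $A$ and $B$, and let $n\in\mathbb N$. If $\mathcal O_{A,B}^{(n+1)}$ is uniformly generated by $n$-ary $(\mathcal A,\mathcal B)$-minors, then $\mathcal C=\langle\mathcal C^{(n)}\rangle_{\mathcal A,\mathcal B}$ for every $(\mathcal A,\mathcal B)$-clonoid $\mathcal C$.
   Context: $\mathbb N=\{1,2,\dots\}$. For sets $A,B$, $\mathcal O_{A,B}=\bigcup_{m\ge 1}B^{A^m}$; for $\mathcal C\subseteq\mathcal O_{A,B}$, $\mathcal C^{(m)}=\mathcal C\cap B^{A^m}$. A clone on $A$ is a set of finitary operations on $A$ containing all projections and closed under composition. An $(\mathcal A,\mathcal B)$-clonoid is a set $\mathcal C\subseteq\mathcal O_{A,B}$ such that for all $m,p\in\mathbb N$: (i) $f_1,\dots,f_p\in\mathcal C^{(m)}$, $g\in\mathcal B^{(p)}$ imply $g\circ(f_1,\dots,f_p)\in\mathcal C^{(m)}$; (ii) $f\in\mathcal C^{(m)}$, $g_1,\dots,g_m\in\mathcal A^{(p)}$ imply $f\circ(g_1,\dots,g_m)\in\mathcal C^{(p)}$. $\langle G\rangle_{\mathcal A,\mathcal B}$ is the smallest $(\mathcal A,\mathcal B)$-clonoid containing $G\subseteq\mathcal O_{A,B}$. $R_n^{k,l}(\mathcal A)$ is the set of maps $r\colon A^k\to A^l$ of the form $r=v\circ w$ with $w\in(\mathcal A^{(k)})^n$ and $v\in(\mathcal A^{(n)})^l$. A set $U\subseteq B^{A^k}$ is uniformly generated by $n$-ary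 $(\mathcal A,\mathcal B)$-minors if there are $m\in\mathbb N$, $s\in\mathcal B^{(m)}$ and $r_1,\dots,r_m\in R_n^{k,k}(\mathcal A)$ such that $f=s\circ(f\circ r_1,\dots,f\circ r_m)$ for every $f\in U$. *)

(* Defs.v *)
From mathcomp Require Import all_boot.
From mathcomp Require Import boolp classical_sets.

Set Implicit Arguments.
Unset Strict Implicit.
Unset Printing Implicit Defensive.

Local Open Scope classical_set_scope.

(* A point of A^m is a map 'I_m -> A, so [op A B m] is B^(A^m). *)
Definition op (A B : Type) (m : nat) : Type := ('I_m -> A) -> B.

(* O_{A,B}, as a disjoint union over the arities m >= 1. *)
Record finop (A B : Type) : Type := Finop {
  arity : nat;
  arity_gt0 : 0 < arity;
  opval : op A B arity }.

(* C^(m), as a set of maps A^m -> B; it is empty for m = 0. *)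
Definition part (A B : Type) (C : set (finop A B)) (m : nat) : set (op A B m) :=
  [set f | exists m_gt0 : 0 < m, C (Finop m_gt0 f)].

(* C^(m), as a subset of O_{A,B}. *)
Definition arity_part (A B : Type) (C : set (finop A B)) (m : nat) :
    set (finop A B) :=
  C `&` [set F | arity F = m].

Definition proj (A : Type) (m : nat) (i : 'I_m) : op A A m := fun x => x i.

Definition tupled (A B : Type) (k l : nat) (g : 'I_l -> op A B k) :
    ('I_k -> A) -> ('I_l -> B) :=
  fun x i => g i x.

Definition opcomp (A B D : Type) (p m : nat) (g : op B D p)
    (f : 'I_p -> op A B m) : op A D m :=
  g \o tupled f.

(* The arities are positive in all the closure conditions below, because
   [part C 0] is empty. *)
Definition is_clone (A : Type) (C : set (finop A A)) : Prop :=
  (forall (m : nat) (i : 'I_m), part C (@proj A m i)) /\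
  (forall (m p : nat) (f : op A A m) (g : 'I_m -> op A A p),
     part C f -> (forall i, part C (g i)) -> part C (opcomp f g)).

Definition is_clonoid (A B : Type) (CA : set (finop A A)) (CB : set (finop B B))
    (C : set (finop A B)) : Prop :=
  (forall (m p : nat) (f : 'I_p -> op A B m) (g : op B B p),
     (forall i, part C (f i)) -> part CB g -> part C (opcomp g f)) /\
  (forall (m p : nat) (f : op A B m) (g : 'I_m -> op A A p),
     part C f -> (forall i, part CA (g i)) -> part C (opcomp f g)).

Definition clonoid_gen (A B : Type) (CA : set (finop A A))
    (CB : set (finop B B)) (G : set (finop A B)) : set (finop A B) :=
  smallest (is_clonoid CA CB) G.

(* R_n^{k,l}(CA) *)
Definition Rmaps (A : Type) (CA : set (finop A A)) (n k l : nat) :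
    set (('I_k -> A) -> ('I_l -> A)) :=
  [set r | exists (w : 'I_n -> op A A k) (v : 'I_l -> op A A n),
     [/\ forall i, part CA (w i), forall j, part CA (v j)
       & r = tupled v \o tupled w]].

Definition uniformly_generated (A B : Type) (CA : set (finop A A))
    (CB : set (finop B B)) (n k : nat) (U : set (op A B k)) : Prop :=
  exists (m : nat) (s : op B B m) (r : 'I_m -> ('I_k -> A) -> ('I_k -> A)),
    [/\ part CB s, forall i, Rmaps CA n (r i)
      & forall f, U f -> f = opcomp s (fun i => f \o r i)].

(* Main.v *)
Require Import Defs.
From mathcomp Require Import all_boot.
From mathcomp Require Import boolp classical_sets.

Local Open Scope classical_set_scope.

(** Freezing the last [d] arguments of an operation of arity [n.+1 + d] leaves
an operation of arity [n.+1], to which the uniform identity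
[f = s (f \o r_1, ..., f \o r_m)] applies with [s] and the [r_i] independent of
the frozen arguments.  Each [r_i] factors through A^n, so the operation is
generated by its minors of arity [n + d]; induction on [d] brings every arity
[n + d] down to [n].  An operation of arbitrary arity [k] is a minor of its
extension by dummy arguments to arity [n + k]. *)

Definition block_cat {A : Type} {k d : nat} (x : 'I_k -> A) (y : 'I_d -> A) :
    'I_(k + d) -> A :=
  fun i => match split i with inl a => x a | inr b => y b end.

(** The product of the map A^k -> A^l given by [w] with the identity of A^d. *)
Definition block_lift {A : Type} (d : nat) {k l : nat} (w : 'I_l -> op A A k) :
    'I_(l + d) -> op A A (k + d) :=
  fun i => match split i with
    | inl a => opcomp (w a) (fun b => proj (lshift d b))
    | inr b => proj (rshift k b)
    end.

Section Blocks.

Variables (A : Type) (CA : set (finop A A)).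
Hypothesis CA_clone : is_clone CA.

Lemma block_cat_lshift_rshift (k d : nat) (x : 'I_(k + d) -> A) :
  block_cat (x \o lshift d) (x \o @rshift k d) = x.
Proof.
by apply/funext => i; rewrite /block_cat -[in RHS](splitK i); case: split.
Qed.

Lemma tupled_block_lift (d k l : nat) (w : 'I_l -> op A A k)
    (x : 'I_(k + d) -> A) :
  tupled (block_lift d w) x
  = block_cat (tupled w (x \o lshift d)) (x \o @rshift k d).
Proof.
by apply/funext => i; rewrite /tupled /block_lift /block_cat; case: split.
Qed.

Lemma tupled_block_lift_cat (d k l : nat) (w : 'I_l -> op A A k)
    (x : 'I_k -> A) (y : 'I_d -> A) :
  tupled (block_lift d w) (block_cat x y) = block_cat (tupled w x) y.
Proof.
rewrite tupled_block_lift; congr (block_cat (tupled w _) _); apply/funext => i.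
- by rewrite /block_cat /= -[lshift d i]/(unsplit (inl i)) unsplitK.
- by rewrite /block_cat /= -[rshift k i]/(unsplit (inr i)) unsplitK.
Qed.

Lemma part_block_lift (d k l : nat) (w : 'I_l -> op A A k) :
  (forall i, part CA (w i)) -> forall i, part CA (block_lift d w i).
Proof.
case: CA_clone => CA_proj CA_comp CAw i.
by rewrite /block_lift; case: split => [a|b] //; apply: CA_comp.
Qed.

End Blocks.

Section Clonoids.

Set Implicit Arguments.
Unset Strict Implicit.

Variables (A B : Type) (CA : set (finop A A)) (CB : set (finop B B)).
Hypothesis CA_clone : is_clone CA.
Variables C D : set (finop A B).
Hypotheses (C_clonoid : is_clonoid CA CB C) (D_clonoid : is_clonoid CA CB D).

Lemma part_sub_le_arity (k l : nat) :
  k <= l -> part C (m := l) `<=` part D (m := l) ->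
  part C (m := k) `<=` part D (m := k).
Proof.
case: CA_clone => CA_proj _ le_kl CD_l f Cf; have [k_gt0 _] := Cf.
case: k le_kl f Cf k_gt0 => // k le_kl f Cf _.
(* The inner composition adds dummy arguments; the outer one restores arity [k.+1]. For [j] beyond
   [k], [inord j] defaults to 0, harmlessly, since [f] ignores those arguments. *)
have -> : f = opcomp (opcomp f (fun i => proj (widen_ord le_kl i)))
                     (fun j : 'I_l => proj (inord j : 'I_k.+1)).
  apply/funext => x; rewrite /opcomp /tupled /proj /=.
  by congr f; apply/funext => i; rewrite /= inord_val.
by apply: D_clonoid.2 => //; apply: CD_l; apply: C_clonoid.2.
Qed.

Lemma part_sub_step (n d : nat) :
  uniformly_generated CA CB n (part [set: finop A B] (m := n.+1)) ->
  part C (m := n + d) `<=` part D (m := n + d) ->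
  part C (m := n.+1 + d) `<=` part D (m := n.+1 + d).
Proof.
move=> [m [s [r [CBs Rr fE]]]] CD f Cf.
pose minor i : op A B (n.+1 + d) :=
  fun x => f (block_cat (r i (x \o lshift d)) (x \o @rshift n.+1 d)).
have -> : f = opcomp s minor.
  apply/funext => x.
  have := fE (fun y => f (block_cat y (x \o @rshift n.+1 d))) _.
  move=> /(_ (ex_intro _ (ltn0Sn n) I)).
  move=> /(congr1 (fun g : op A B n.+1 => g (x \o lshift d))).
  by rewrite block_cat_lshift_rshift.
apply: D_clonoid.1 => // i; have [w [v [CAw CAv rE]]] := Rr i.
(* With [r i] factored as [v] after [w], composing [f] with the lift of [v] alone gives a member of
   [C] of arity [n + d], where [CD] applies. *)
have -> : minor i = opcomp (opcomp f (block_lift d v)) (block_lift d w).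
  apply/funext => x; rewrite /minor rE /opcomp /=.
  by rewrite (tupled_block_lift _ _ _ _ w) tupled_block_lift_cat.
apply: D_clonoid.2; last exact: part_block_lift.
by apply: CD; apply: C_clonoid.2 => //; apply: part_block_lift.
Qed.

Lemma part_sub_uniformly_generated (n d : nat) :
  uniformly_generated CA CB n (part [set: finop A B] (m := n.+1)) ->
  part C (m := n) `<=` part D (m := n) ->
  part C (m := n + d) `<=` part D (m := n + d).
Proof.
move=> ug CD; elim: d => [|d IHd]; first by rewrite addn0.
by rewrite addnS -addSn; apply: part_sub_step.
Qed.

End Clonoids.

Theorem corollary20 (A B : Type) (CA : set (finop A A)) (CB : set (finop B B))
    (n : nat) (CA_clone : is_clone CA) (CB_clone : is_clone CB)
    (n_gt0 : 0 < n)
    (ug : uniformly_generated CA CB n (part [set: finop A B] (m := n.+1))) :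
  forall C : set (finop A B), is_clonoid CA CB C ->
    C = clonoid_gen CA CB (arity_part C n).
Proof.
move=> C C_clonoid; apply/seteqP; split; last first.
  by apply: smallest_sub => // F [].
(* The generated clonoid is the intersection of all clonoids [D] containing C^(n), so one such [D]
   is fixed. *)
move=> [k k_gt0 f] Cf D [D_clonoid CnD].
have CD_n : part C (m := n) `<=` part D (m := n).
  by move=> g [gt0 Cg]; exists gt0; apply: CnD.
(* Arity [n + k] is reachable from [n] and is at least [k], so no comparison of [k] with [n] is
   required. *)
have CD_nk := part_sub_uniformly_generated CA_clone C_clonoid D_clonoid
  (d := k) ug CD_n.
have [gt0] := part_sub_le_arity CA_clone C_clonoid D_clonoid (leq_addl n k) CD_nk
  (ex_intro _ k_gt0 Cf).
by rewrite (bool_irrelevance gt0 k_gt0).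
Qed.
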